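(* Let $k\ge 3$, $\tau\in\mathcal{S}_k$ with $\tau(k-1)=k-1$, $\tau(k)=k$, and $\widetilde\tau$ as in the context. The restriction of $\alpha$ to the set $F_n(213,\widetilde\tau)$ of forests on $[n]$ avoiding $213$ and $\widetilde\tau$, and the restriction of $\beta$ to the set $F_n(213,\tau)$ of forests on $[n]$ avoiding $213$ and $\tau$, give mutually inverse maps $\alpha\colon F_n(213,\widetilde\tau)\to F_n(213,\tau)$ and $\beta\colon F_n(213,\tau)\to F_n(213,\widetilde\tau)$.
   Context: Forests on $[n]$ are unordered rooted forests with vertices labeled bijectively by $[n]$. An instance of a pattern $\rho\in\mathcal{S}_j$ is a sequence $v_1,\dots,v_j$ of vertices with $v_a$ a strict ancestor of $v_b$ for $a<b$ and labels in the same relative order as $\rho$; $v_j$ is its endpoint; avoiding $\rho$ means having no instance. Let $\widetilde\tau(i)=\tau(i)$ for $i\le k-2$, $\widetilde\tau(k-1)=k$, $\widetilde\tau(k)=k-1$, and $\bar\tau\in\mathcal{S}_{k-1}$ with $\bar\tau(i)=\tau(i)$ for $i\le k-2$, $\bar\tau(k-1)=k-1$. A vertex is special if it is the endpoint of an instance of $\bar\tau$. For special $v$ with subtree label set $L$ (labels of all descendants of $v$ including $v$), let $x=\max L$ and let $y$ be the least element of $L$ such that $v$ would remain special if labeled $y$. Shuffling $v$ means labeling $v$ by $x$ and relabeling its strict descendants by $L\setminus\{x\}$ preserving their relative order; antishuffling $v$ means labeling $v$ by $y$ and relabeling its strict descendants by $L\setminus\{y\}$ preserving relative order. The map $\alpha$: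 traverse the vertices in reverse breadth-first order (each vertex after all its strict descendants, ending with the roots), shuffling each visited vertex that is special. The map $\beta$: traverse in breadth-first order (each vertex after all its strict ancestors), antishuffling each visited vertex that is special. *)

(* Defs.v *)
From mathcomp Require Import all_boot.

Set Implicit Arguments.
Unset Strict Implicit.
Unset Printing Implicit Defensive.

(* Permutations of {1, .., j} are words in one-line notation, i.e., elements  *)
(* of [permutations (iota 1 j)].                                              *)

Definition pat213 : seq nat := [:: 2; 1; 3].

(* tilde k tau = tau(1) .. tau(k-2) k (k-1);                                  *)
(* bar k tau = tau(1) .. tau(k-2) (k-1).                                      *)
Definition tilde (k : nat) (tau : seq nat) : seq nat :=
  take (k - 2) tau ++ [:: k; k - 1].
Definition bar (k : nat) (tau : seq nat) : seq nat :=
  rcons (take (k - 2) tau) (k - 1).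

(* A forest on [n] is given by its parent function on the set 'I_n of labels, *)
(* the label i of the paper being i - 1 here; roots are mapped to None.       *)
Notation parents n := {ffun 'I_n -> option 'I_n}.

Definition strict_anc (n : nat) (f : parents n) (u v : 'I_n) : bool :=
  [exists w, (f v == Some w) && connect [rel x y | f x == Some y] w u].

Definition is_forest (n : nat) (f : parents n) : bool :=
  [forall v, ~~ strict_anc f v v].

Definition subtree (n : nat) (f : parents n) (v : 'I_n) : {set 'I_n} :=
  [set u | (u == v) || strict_anc f v u].

(* During the traversals the underlying vertices stay fixed (they are named   *)
(* by their initial labels) and only the labeling l of the vertices evolves.  *)

Definition instance_of (n : nat) (f : parents n) (l : 'I_n -> 'I_n)
    (rho : seq nat) (vs : (size rho).-tuple 'I_n) : bool :=
  [forall a : 'I_(size rho), forall b : 'I_(size rho),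
     ((a < b) ==> strict_anc f (tnth vs a) (tnth vs b)) &&
     ((l (tnth vs a) < l (tnth vs b)) == (nth 0 rho a < nth 0 rho b))].

Definition avoids (n : nat) (f : parents n) (rho : seq nat) : bool :=
  ~~ [exists vs : (size rho).-tuple 'I_n, instance_of f id vs].

Definition forests_avoiding (n : nat) (pats : seq (seq nat)) :
    {set parents n} :=
  [set f | is_forest f & all (avoids f) pats].

Definition special (n : nat) (rho : seq nat) (f : parents n)
    (l : 'I_n -> 'I_n) (v : 'I_n) : bool :=
  [exists vs : (size rho).-tuple 'I_n,
     instance_of f l vs && (onth vs (size rho).-1 == Some v)].

Definition label_set (n : nat) (f : parents n) (l : 'I_n -> 'I_n) (v : 'I_n) :
    {set 'I_n} :=
  l @: subtree f v.

(* Label v by y and its strict descendants by L \ {y}, in the same relative   *)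
(* order; [enum] lists a set of ordinals increasingly.                        *)
Definition relabel_subtree (n : nat) (f : parents n) (l : 'I_n -> 'I_n)
    (v y : 'I_n) : 'I_n -> 'I_n :=
  let L := label_set f l v in
  fun u => if u == v then y
           else if strict_anc f v u then
             nth y (enum (L :\ y)) (index (l u) (enum (L :\ l v)))
           else l u.

Definition shuffle (n : nat) (f : parents n) (l : 'I_n -> 'I_n) (v : 'I_n) :
    'I_n -> 'I_n :=
  relabel_subtree f l v [arg max_(x > l v in label_set f l v) (x : nat)].

(* If v is special then l v satisfies the predicate, so the minimum exists.   *)
Definition antishuffle (n : nat) (rho : seq nat) (f : parents n)
    (l : 'I_n -> 'I_n) (v : 'I_n) : 'I_n -> 'I_n :=
  relabel_subtree f l v
    [arg min_(y < l v | (y \in label_set f l v) &&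
                        special rho f [eta l with v |-> y] v) (y : nat)].

(* The forest on [n] obtained by naming each vertex v by its label l v.       *)
Definition named_by (n : nat) (f : parents n) (l : 'I_n -> 'I_n) : parents n :=
  [ffun i => omap l (f (finv l i))].

(* In an unordered forest a breadth-first order is not unique; the only       *)
(* property retained is that strict ancestors come first. Level orders are    *)
(* examples, see [level_order_ancestors_first] below.                         *)
Definition ancestors_first (n : nat) (f : parents n) (s : seq 'I_n) : bool :=
  perm_eq s (enum 'I_n) && pairwise (fun u v => ~~ strict_anc f v u) s.

(* The traversal order is a parameter, [ord f] listing ancestors first.       *)
Definition alpha (n : nat) (rho : seq nat) (ord : parents n -> seq 'I_n)
    (f : parents n) : parents n :=
  named_by f
    (foldl (fun l v => if special rho f l v then shuffle f l v else l)
       id (rev (ord f))).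

Definition beta (n : nat) (rho : seq nat) (ord : parents n -> seq 'I_n)
    (f : parents n) : parents n :=
  named_by f
    (foldl (fun l v => if special rho f l v then antishuffle rho f l v else l)
       id (ord f)).

Lemma strict_anc_trans n (f : parents n) : transitive (strict_anc f).
Proof.
move=> v u w /existsP[a /andP[fv au]] /existsP[b /andP[fw bv]].
apply/existsP; exists b; rewrite fw /=; apply: connect_trans bv _.
by apply: connect_trans au; apply: connect1.
Qed.

Definition depth (n : nat) (f : parents n) (v : 'I_n) : nat :=
  #|[set u | strict_anc f u v]|.

Lemma depth_strict_anc n (f : parents n) u v :
  is_forest f -> strict_anc f u v -> depth f u < depth f v.
Proof.
move=> /forallP hf huv; apply: proper_card; apply/properP; split.
  by apply/subsetP => w; rewrite !inE => hwu; apply: strict_anc_trans huv.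
by exists u; rewrite !inE ?hf.
Qed.

Lemma level_order_ancestors_first n (f : parents n) (s : seq 'I_n) :
    is_forest f -> perm_eq s (enum 'I_n) ->
    sorted (fun u v => depth f u <= depth f v) s ->
  ancestors_first f s.
Proof.
move=> hf hs; rewrite sorted_pairwise => [|v u w /=]; last exact: leq_trans.
rewrite /ancestors_first hs; apply: sub_pairwise => u v /=.
by rewrite leqNgt; apply: contra; apply: depth_strict_anc.
Qed.

(* Main.v *)
(* Write tau = sigma r r' with sigma < r < r'. Whether a vertex v is special
   depends only on the labels of its ancestors and is monotone in the label of
   v; so a forest avoids tau iff every special v has the largest label of its
   subtree, and avoids tilde tau iff every special v has the least label of its
   subtree with which it would be special. Shuffling or antishuffling a special
   v only alters labels large enough to be special below v, hence it keeps the
   set of special vertices, and it does not disturb the extremality of the other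
   special vertices. As 213 is avoided, no ancestor of v has a label between the
   old and the new label of v, so relative orders with the ancestors, and with
   them the avoidance of 213, are kept too. Each step of alpha is therefore
   undone by the corresponding step of beta. The traversal orders of alpha and
   beta may be unrelated, but shuffles at incomparable vertices commute. *)

Require Import Defs.
From mathcomp Require Import all_boot zify.
From Stdlib Require Import FunctionalExtensionality.

Set Implicit Arguments.
Unset Strict Implicit.
Unset Printing Implicit Defensive.

(** A strictly sorted sequence lists before [x] exactly the elements related to [x], so the position
    of [x] is their number. *)
Lemma index_sorted_count (T : eqType) (r : rel T) (s : seq T) (x : T) :
  irreflexive r -> transitive r -> sorted r s -> x \in s ->
  index x s = count (r^~ x) s.
Proof.
move=> ir tr; elim: s => //= a s IHs srs.
have ars : all (r a) s by apply: order_path_min.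
rewrite inE; case: (eqVneq x a) => [->|/= nxa xs].
  rewrite ir => _; apply/esym/eqP; rewrite add0n -leqn0 leqNgt -has_count.
  apply/hasPn => z zs; apply/negP => rza.
  by have := tr _ _ _ (allP ars z zs) rza; rewrite ir.
by rewrite (allP ars) // IHs ?(path_sorted srs).
Qed.

(** * Increasing bijections between finite sets of labels *)

Section OrderTransport.
Variable n : nat.
Implicit Types (A B L : {set 'I_n}) (x y : 'I_n).

Lemma enum_set_sorted A : sorted (fun x y : 'I_n => x < y) (enum A).
Proof.
have -> : enum A = [seq x <- enum 'I_n | x \in A] by rewrite {1}/enum_mem -enumT.
apply: sorted_filter; first exact: ltn_trans.
have := iota_ltn_sorted 0 n; rewrite -val_enum_ord sorted_map.
by apply: sub_sorted.
Qed.

Lemma index_enum_card A x :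
  x \in A -> index x (enum A) = #|[set z in A | z < x]|.
Proof.
move=> xA; rewrite (index_sorted_count _ _ (enum_set_sorted A)) ?mem_enum //.
- rewrite -size_filter cardE; apply: perm_size; apply: uniq_perm.
  + by rewrite filter_uniq ?enum_uniq.
  + by rewrite enum_uniq.
  + by move=> z; rewrite mem_filter !mem_enum inE andbC.
- by move=> z; rewrite ltnn.
- by move=> a b c; apply: ltn_trans.
Qed.

(** For [A] and [B] of equal cardinality this is the increasing bijection from [A] to [B]; [x0] is
    only the default of [nth]. *)
Definition transport A B x0 x : 'I_n := nth x0 (enum B) (index x (enum A)).

Lemma transport_in A B x0 x :
  #|A| = #|B| -> x \in A -> transport A B x0 x \in B.
Proof.
move=> eAB xA; rewrite -mem_enum mem_nth // -cardE -eAB cardE index_mem.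
by rewrite mem_enum.
Qed.

Lemma transportK A B x0 x1 x :
  #|A| = #|B| -> x \in A -> transport B A x1 (transport A B x0 x) = x.
Proof.
move=> eAB xA; rewrite /transport index_uniq ?enum_uniq //.
  by rewrite nth_index // mem_enum.
by rewrite -cardE -eAB cardE index_mem mem_enum.
Qed.

Lemma index_enum_lt A x y :
  x \in A -> y \in A -> (index x (enum A) < index y (enum A)) = (x < y).
Proof.
have H a b : a \in A -> b \in A -> a < b -> index a (enum A) < index b (enum A).
  move=> aA bA ab; rewrite !index_enum_card //; apply: proper_card.
  apply/properP; split.
    by apply/subsetP => z; rewrite !inE => /andP[-> /=] /ltn_trans; apply.
  by exists a; rewrite !inE ?aA ?ab // ltnn andbF.
move=> xA yA; case: (ltngtP x y) => [xy|yx|/val_inj ->]; first exact: H.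
- by apply/negbTE; rewrite -leqNgt ltnW // H.
- by rewrite ltnn.
Qed.

Lemma transport_lt A B x0 x y : #|A| = #|B| -> x \in A -> y \in A ->
  (transport A B x0 x < transport A B x0 y) = (x < y).
Proof.
move=> eAB xA yA; rewrite -(@index_enum_lt B) ?transport_in //.
by rewrite /transport !index_uniq ?enum_uniq -?cardE -?eAB ?cardE ?index_mem
  ?mem_enum // index_enum_lt.
Qed.

Lemma cardsD1_eq L a b : a \in L -> b \in L -> #|L :\ a| = #|L :\ b|.
Proof.
by move=> aL bL; have := cardsD1 a L; rewrite (cardsD1 b L) aL bL => -[].
Qed.

(** The position counts the smaller elements, and either both or none of [a] and [b] are among
    them. *)
Lemma index_enumD1 L a b x : a \in L -> b \in L -> x \in L ->
  (x < a) && (x < b) || (a < x) && (b < x) ->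
  index x (enum (L :\ a)) = index x (enum (L :\ b)).
Proof.
move=> aL bL xL H; rewrite !index_enum_card ?inE ?xL ?andbT; last first.
- by apply/eqP => xb; move: H; rewrite xb; lia.
- by apply/eqP => xb; move: H; rewrite xb; lia.
have E c : [set z in L :\ c | z < x] = [set z in L | z < x] :\ c.
  by apply/setP => z; rewrite !inE andbA.
rewrite !E; have := cardsD1 a [set z in L | z < x].
rewrite (cardsD1 b [set z in L | z < x]) !inE aL bL /=.
by case/orP: H => /andP[? ?]; case: ltnP; case: ltnP; lia.
Qed.

(* An element outside the interval spanned by [a] and [b] has as many
   predecessors in [L :\ a] as in [L :\ b]. *)
Lemma transportD1_fixed L a b x0 x : a \in L -> b \in L -> x \in L ->
  (x < a) && (x < b) || (a < x) && (b < x) ->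
  transport (L :\ a) (L :\ b) x0 x = x.
Proof.
move=> aL bL xL H; rewrite /transport (index_enumD1 aL bL xL H) nth_index //.
rewrite mem_enum !inE xL andbT; apply/eqP => xb; move: H; rewrite xb; lia.
Qed.

(** An [x] outside the interval is fixed. If instead its image is outside, the inverse transport
    fixes that image, which therefore equals [x]. *)
Lemma transportD1_interval L a b x0 x : a \in L -> b \in L -> x \in L :\ a ->
  let x' := transport (L :\ a) (L :\ b) x0 x in
  x' = x \/ minn a b <= x <= maxn a b /\ minn a b <= x' <= maxn a b.
Proof.
move=> aL bL xLa x'; have eAB := cardsD1_eq aL bL.
have x'L : x' \in L :\ b by apply: transport_in.
have [xL x'L0] : x \in L /\ x' \in L.
  by move: xLa x'L; rewrite !inE => /andP[_ ->] /andP[_ ->].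
case: (boolP ((x < a) && (x < b) || (a < x) && (b < x))) => H.
  by left; apply: transportD1_fixed.
case: (boolP ((x' < a) && (x' < b) || (a < x') && (b < x'))) => H'.
  left; have := transportK x0 x0 eAB xLa; rewrite -/x' => <-.
  by apply/esym; apply: transportD1_fixed => //; move: H'; lia.
by right; lia.
Qed.

End OrderTransport.

(** * Ancestors and subtrees *)

Section Ancestors.
Variables (n : nat) (f : parents n).
Implicit Types u v w : 'I_n.

Let up : rel 'I_n := [rel x y | f x == Some y].

(** Reachability along parents makes the path lemmas of [connect] available for subtrees. *)
Lemma connect_subtree v u : (u \in subtree f v) = connect up u v.
Proof.
rewrite inE; apply/orP/idP => [[/eqP->|]|]; first exact: connect0.
  case/existsP => w /andP[uw]; apply: connect_trans; exact: connect1.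
case/connectP => -[|w p] /=; first by move=> _ ->; left.
case/andP => uw pth ev; right; apply/existsP; exists w; apply/andP; split=> //.
by apply/connectP; exists p.
Qed.

Lemma subtree_id v : v \in subtree f v.
Proof. by rewrite inE eqxx. Qed.

Lemma subtree_strict v u : strict_anc f v u -> u \in subtree f v.
Proof. by rewrite inE orbC => ->. Qed.

Lemma subtreeE v u : u \in subtree f v -> u = v \/ strict_anc f v u.
Proof. by rewrite inE => /predU1P. Qed.

Lemma strict_anc_subtree v u w :
  strict_anc f v u -> w \in subtree f u -> strict_anc f v w.
Proof. by move=> vu /subtreeE[-> //|]; apply: strict_anc_trans vu. Qed.

Lemma subtree_strict_anc v u w :
  u \in subtree f v -> strict_anc f u w -> strict_anc f v w.
Proof. by case/subtreeE => [-> //|vu]; apply: strict_anc_trans. Qed.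

Lemma subtreeS v w : v \in subtree f w -> subtree f v \subset subtree f w.
Proof.
move=> vw; apply/subsetP => u; rewrite !connect_subtree in vw * => uv.
exact: connect_trans vw.
Qed.

(** Parents are unique, so the upward paths from [w] to [u] and to [v] coincide until the shorter
    one ends. *)
Lemma subtree_total u v w :
  w \in subtree f u -> w \in subtree f v ->
  u \in subtree f v \/ v \in subtree f u.
Proof.
rewrite !connect_subtree => /connectP[p pth ->] {u}.
elim: p w pth => [|a p IHp] w /=; first by left.
case/andP => wa pth /connectP[[|b q]] /=.
  move=> _ ->; right; apply/connectP; exists (a :: p) => //=; exact/andP.
case/andP => /eqP wb qth ev; move/eqP: wa; rewrite wb => -[eba].
by apply: IHp => //; apply/connectP; exists q; rewrite -eba.
Qed.

Hypothesis hf : is_forest f.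

Lemma strict_ancxx v : strict_anc f v v = false.
Proof. by apply/negbTE; move/forallP: hf. Qed.

Lemma strict_anc_neq u v : strict_anc f u v -> u != v.
Proof. by apply: contraTneq => ->; rewrite strict_ancxx. Qed.

Lemma strict_anc_notin_subtree u v : strict_anc f u v -> u \notin subtree f v.
Proof.
move=> uv; apply/negP => /(strict_anc_subtree uv); by rewrite strict_ancxx.
Qed.

Lemma strict_anc_total u v w : strict_anc f u w -> strict_anc f v w ->
  [\/ u = v, strict_anc f u v | strict_anc f v u].
Proof.
move=> /subtree_strict uw /subtree_strict vw.
case: (subtree_total uw vw) => /subtreeE[->|]; by [constructor 1|constructor 2|constructor 3].
Qed.

Lemma strict_anc_subtree_cases u v w :
  strict_anc f u w -> w \in subtree f v -> u \in subtree f v \/ strict_anc f u v.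
Proof.
move=> uw wv; case: (subtree_total (subtree_strict uw) wv); first by left.
by case/subtreeE => [->|]; [left; apply: subtree_id|right].
Qed.

End Ancestors.

(** * Relabeling a subtree *)

(** Stated for an arbitrary labeling, because the traversals change the labels while the underlying
    forest stays fixed. *)
Definition avoids213 n (f : parents n) (l : 'I_n -> 'I_n) : Prop :=
  forall a b c, strict_anc f a b -> strict_anc f b c -> ~~ (l b < l a < l c).

Section Relabel.
Variables (n : nat) (f : parents n) (v : 'I_n).
Hypothesis hf : is_forest f.
Implicit Types (l : 'I_n -> 'I_n) (u w y : 'I_n).

Lemma relabel_out l y u :
  u \notin subtree f v -> relabel_subtree f l v y u = l u.
Proof.
by rewrite inE negb_or /relabel_subtree => /andP[/negPf-> /negPf->].
Qed.

Lemma relabel_top l y : relabel_subtree f l v y v = y.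
Proof. by rewrite /relabel_subtree eqxx. Qed.

Lemma relabel_in l y u : strict_anc f v u ->
  relabel_subtree f l v y u =
  transport (label_set f l v :\ l v) (label_set f l v :\ y) y (l u).
Proof.
move=> vu; rewrite /relabel_subtree vu eq_sym.
by rewrite (negPf (strict_anc_neq hf vu)).
Qed.

Lemma mem_label_set l u :
  injective l -> (l u \in label_set f l v) = (u \in subtree f v).
Proof. exact: mem_imset. Qed.

Lemma label_set_in l u : u \in subtree f v -> l u \in label_set f l v.
Proof. exact: imset_f. Qed.

Variables (l : 'I_n -> 'I_n) (y : 'I_n).
Hypotheses (linj : injective l) (yL : y \in label_set f l v).
Let l' := relabel_subtree f l v y.

Let lvL : l v \in label_set f l v.
Proof. exact: label_set_in (subtree_id f v). Qed.

Let card_eq : #|label_set f l v :\ l v| = #|label_set f l v :\ y|.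
Proof. exact: cardsD1_eq. Qed.

Let strict_in u : strict_anc f v u -> l u \in label_set f l v :\ l v.
Proof.
move=> vu; rewrite !inE (inj_eq linj) eq_sym (strict_anc_neq hf) //=.
exact: label_set_in (subtree_strict vu).
Qed.

Let relabel_strict_in u : strict_anc f v u -> l' u \in label_set f l v :\ y.
Proof. by move=> vu; rewrite /l' relabel_in // transport_in // strict_in. Qed.

Lemma relabel_lt u w : strict_anc f v u -> strict_anc f v w ->
  (l' u < l' w) = (l u < l w).
Proof. by move=> vu vw; rewrite /l' !relabel_in // transport_lt // strict_in. Qed.

Lemma relabel_interval u : u \in subtree f v ->
  l' u = l u \/
  minn (l v) y <= l u <= maxn (l v) y /\ minn (l v) y <= l' u <= maxn (l v) y.
Proof.
case/subtreeE => [->|vu]; first by right; rewrite /l' relabel_top; lia.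
by rewrite /l' relabel_in //; apply: transportD1_interval => //; apply: strict_in.
Qed.

Lemma relabel_label_in u : u \in subtree f v -> l' u \in label_set f l v.
Proof.
case/subtreeE => [->|vu]; first by rewrite /l' relabel_top.
by have := relabel_strict_in vu; rewrite inE => /andP[].
Qed.

(** The subtree keeps its label set, so it cannot clash with the outside; within it the strict
    descendants avoid [y] and keep their order. *)
Lemma relabel_inj : injective l'.
Proof.
have Hstrict u : strict_anc f v u -> l' u != y.
  by move/relabel_strict_in; rewrite !inE => /andP[].
have Hin u w : u \in subtree f v -> w \in subtree f v -> l' u = l' w -> u = w.
  move=> /subtreeE[->|vu] /subtreeE[->|vw] //.
  - by rewrite {1}/l' relabel_top => /esym/eqP; rewrite (negPf (Hstrict _ vw)).
  - by rewrite {2}/l' relabel_top => /eqP; rewrite (negPf (Hstrict _ vu)).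
  move=> e; apply/linj/val_inj/eqP => /=; have := relabel_lt vu vw.
  have := relabel_lt vw vu; rewrite e ltnn; lia.
have Hmix u w : u \in subtree f v -> w \notin subtree f v -> l' u <> l' w.
  move=> us wns e; have := relabel_label_in us.
  by rewrite e /l' relabel_out // mem_label_set // (negPf wns).
move=> u w e; case: (boolP (u \in subtree f v)) => us;
  case: (boolP (w \in subtree f v)) => ws.
- exact: Hin.
- by case: (Hmix _ _ us ws).
- by case: (Hmix _ _ ws us).
- by apply: linj; move: e; rewrite /l' !relabel_out.
Qed.

Lemma relabel_image (S : {set 'I_n}) : subtree f v \subset S -> l' @: S = l @: S.
Proof.
move=> vS; apply/eqP; rewrite eqEcard !card_imset ?leqnn ?andbT //; last first.
  exact: relabel_inj.
apply/subsetP => _ /imsetP[u uS ->].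
case: (boolP (u \in subtree f v)) => us; last first.
  by rewrite /l' relabel_out // imset_f.
by have := relabel_label_in us; apply/subsetP/imsetS.
Qed.

Lemma relabel_label_set : label_set f l' v = label_set f l v.
Proof. exact: relabel_image. Qed.

(** The label set is unchanged, so giving [v] its old label transports the other labels back along
    the inverse bijection. *)
Lemma relabelK : relabel_subtree f l' v (l v) = l.
Proof.
apply: functional_extensionality => u.
case: (boolP (u \in subtree f v)) => [|us]; last first.
  by rewrite relabel_out // /l' relabel_out.
case/subtreeE => [->|vu]; first by rewrite relabel_top.
rewrite relabel_in // relabel_label_set /l' relabel_top relabel_in //.
by rewrite transportK // strict_in.
Qed.

(** By the first hypothesis, labels in the subtree keep their order relative to every ancestor of
    [v]; the second excludes occurrences of 213 starting at [v]. Any other triple is unaltered or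
    keeps its relative order. *)
Lemma relabel_avoids213 :
    (forall p, strict_anc f p v -> ~~ (minn (l v) y <= l p <= maxn (l v) y)) ->
    (forall q t, strict_anc f v q -> strict_anc f q t -> ~~ (l' q < y < l' t)) ->
  avoids213 f l -> avoids213 f l'.
Proof.
move=> gap Hv H p q t pq qt.
have pt := strict_anc_trans pq qt.
have [ts|ts] := boolP (t \in subtree f v); last first.
  have qs : q \notin subtree f v.
    by apply: contra ts => qs; apply/subtree_strict/(subtree_strict_anc qs qt).
  have ps : p \notin subtree f v.
    by apply: contra qs => ps; apply/subtree_strict/(subtree_strict_anc ps pq).
  by rewrite /l' !relabel_out // H.
have [/subtreeE[epv|vp]|pv] := strict_anc_subtree_cases pt ts.
- by rewrite epv in pq pt *; rewrite {2 3}/l' relabel_top Hv.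
- by rewrite /l' !relabel_lt ?H //; apply: strict_anc_trans vp _.
have lp : l' p = l p by rewrite /l' relabel_out ?strict_anc_notin_subtree.
(* A label that moves stays in the interval spanned by [l v] and [y], and [l p] lies outside it. *)
have order_kept u : u \in subtree f v ->
    (l' u < l p) = (l u < l p) /\ (l p < l' u) = (l p < l u).
  move=> us; have := gap _ pv.
  by have := relabel_interval us; rewrite -/l' => -[->//|]; lia.
rewrite lp; have [_ ->] := order_kept _ ts.
have [qs|qs] := boolP (q \in subtree f v); last by rewrite /l' relabel_out // H.
by have [-> _] := order_kept _ qs; rewrite H.
Qed.

End Relabel.

(** * Pattern instances *)

Section Patterns.
Variables (n : nat) (f : parents n).
Implicit Types (l : 'I_n -> 'I_n) (u v d : 'I_n) (rho : seq nat).

(** Pairing vertices with pattern entries turns an instance into a pairwise condition on a zipped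
    sequence, which is convenient for appending a last entry. *)
Definition pair_occ l (p q : 'I_n * nat) : bool :=
  [&& strict_anc f p.1 q.1, (l p.1 < l q.1) == (p.2 < q.2)
    & (l q.1 < l p.1) == (q.2 < p.2)].

Definition occ l rho (vs : seq 'I_n) : bool :=
  (size vs == size rho) && pairwise (pair_occ l) (zip vs rho).

(** Pairs of increasing positions suffice, since [pair_occ] records both label comparisons. *)
Lemma instance_ofE l rho (vs : (size rho).-tuple 'I_n) :
  instance_of f l vs = occ l rho vs.
Proof.
rewrite /occ size_tuple eqxx /=.
(* A nonempty tuple provides the default vertex [x0] for [nth]. *)
case E: (tval vs) => [|x0 s].
  have := size_tuple vs; rewrite E /= => /esym/size0nil e0.
  have -> : zip [::] rho = [::] :> seq ('I_n * nat) by case: (rho).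
  by apply/forallP => a; have := ltn_ord a; rewrite {2}e0.
rewrite -E; apply/idP/(pairwiseP (x0, 0)) => [/forallP H i j|H].
  rewrite !inE size_zip size_tuple minnn => i_lt j_lt ij.
  have /forallP/(_ (Ordinal j_lt)) := H (Ordinal i_lt).
  have /forallP/(_ (Ordinal i_lt)) := H (Ordinal j_lt).
  rewrite !nth_zip ?size_tuple // !(tnth_nth x0) /= ij /=.
  by case/andP => _ ba /andP[iji ab]; rewrite /pair_occ /= iji ab.
have Hlt (a b : 'I_(size rho)) : a < b ->
    pair_occ l (tnth vs a, nth 0 rho a) (tnth vs b, nth 0 rho b).
  move=> ab; have := H a b; rewrite !inE size_zip size_tuple minnn !ltn_ord.
  by rewrite !nth_zip ?size_tuple // !(tnth_nth x0); apply.
apply/forallP => a; apply/forallP => b; case: (ltngtP a b) => ab /=.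
- by have /and3P[/= -> ->] := Hlt _ _ ab.
- by have /and3P[/= _ _ ->] := Hlt _ _ ab.
- by have -> : a = b by [apply: val_inj]; rewrite !ltnn.
Qed.

Lemma exists_instance l rho (P : seq 'I_n -> bool) :
  [exists vs : (size rho).-tuple 'I_n, instance_of f l vs && P vs] <->
  exists2 vs, occ l rho vs & P vs.
Proof.
split=> [/existsP[vs /andP[]]|[vs H Pvs]].
  by rewrite instance_ofE => H Pvs; exists vs.
case/andP: (H) => sz _; apply/existsP; exists (Tuple sz).
by rewrite instance_ofE H.
Qed.

Lemma exists_occ l rho :
  [exists vs : (size rho).-tuple 'I_n, instance_of f l vs] <->
  exists vs, occ l rho vs.
Proof.
split=> [/existsP[vs]|[vs H]]; first by rewrite instance_ofE => H; exists vs.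
by case/andP: (H) => sz _; apply/existsP; exists (Tuple sz); rewrite instance_ofE.
Qed.

Lemma occ_rcons l rho r vs v : occ l (rcons rho r) (rcons vs v) =
  occ l rho vs && all (pair_occ l ^~ (v, r)) (zip vs rho).
Proof.
rewrite /occ !size_rcons eqSS; case: eqP => //= sz.
by rewrite zip_rcons // pairwise_rcons andbC.
Qed.

(** As [r] exceeds every entry of [rho], both label comparisons reduce to [l u < l v], whichever
    entry [u] is paired with. *)
Lemma all_pair_occ_max l rho r vs v : size vs = size rho ->
  all (ltn^~ r) rho ->
  all (pair_occ l ^~ (v, r)) (zip vs rho) =
  all (fun u => strict_anc f u v) vs && all (fun u => l u < l v) vs.
Proof.
move=> sz /allP rho_lt.
have -> : all (pair_occ l ^~ (v, r)) (zip vs rho) =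
          all (fun p => strict_anc f p.1 v && (l p.1 < l v)) (zip vs rho).
  apply: eq_in_all => p pin; rewrite /pair_occ /=.
  have p_lt : p.2 < r.
    apply: rho_lt; rewrite -(@unzip2_zip _ _ vs rho) ?sz //; exact: map_f.
  have -> : (r < p.2) = false by lia.
  by rewrite p_lt eqb_id; case: (strict_anc _ _ _) => //=; lia.
rewrite -all_predI -[in RHS](@unzip1_zip _ _ vs rho) ?sz // all_map.
exact: eq_all.
Qed.

(** * Patterns extending [sigma] by larger entries *)

Variables (sigma : seq nat) (r r' : nat).
Hypotheses (sigma_lt : all (ltn^~ r) sigma) (rr' : r < r').

(* [v] would be special if it were labeled [x]. *)
Definition supported l v (x : nat) : Prop :=
  exists vs, [/\ occ l sigma vs, all (fun u => strict_anc f u v) vs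
    & all (fun u => l u < x) vs].

Lemma supportedW l v x x' : supported l v x -> x <= x' -> supported l v x'.
Proof.
case=> vs [ovs avs lvs] xx'; exists vs; split=> //.
by apply: sub_all lvs => u /leq_trans; apply.
Qed.

Lemma occ_rcons_max l r0 vs v : all (ltn^~ r0) sigma ->
  occ l (rcons sigma r0) (rcons vs v) = [&& occ l sigma vs,
    all (fun u => strict_anc f u v) vs & all (fun u => l u < l v) vs].
Proof.
move=> lt0; rewrite occ_rcons; case E: (occ l sigma vs) => //=.
by case/andP: E => /eqP sz _; rewrite all_pair_occ_max.
Qed.

Lemma occ_rconsE l rho r0 vs : occ l (rcons rho r0) vs ->
  exists vs0 v, vs = rcons vs0 v.
Proof.
case/andP => /eqP; rewrite size_rcons => sz _.
by case/lastP: vs sz => [//|vs0 v] _; exists vs0, v.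
Qed.

(** Since [r] exceeds all of [sigma], the label of the endpoint matters only as an upper bound for
    the labels of the witness. *)
Lemma specialP l v : special (rcons sigma r) f l v <-> supported l v (l v).
Proof.
apply: iff_trans (exists_instance l _ (fun vs => onth vs _ == Some v)) _.
rewrite size_rcons /=; split=> [[vs H]|[vs [ovs avs lvs]]].
  have [vs0 [w evs]] := occ_rconsE H; rewrite evs in H *.
  move: H; rewrite occ_rcons_max // => /and3P[ovs avs lvs].
  have [/eqP sz _] := andP ovs.
  rewrite onthE map_rcons nth_rcons size_map -sz ltnn eqxx => /eqP[<-].
  by exists vs0.
exists (rcons vs v); first by rewrite occ_rcons_max // ovs avs.
have [/eqP sz _] := andP ovs.
by rewrite onthE map_rcons nth_rcons size_map -sz ltnn eqxx.
Qed.

(** The vertex in position [r] is special, and a larger label below it automatically exceeds those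
    of the witness. *)
Lemma occ_above l :
  [exists vs : (size (rcons (rcons sigma r) r')).-tuple 'I_n, instance_of f l vs]
  <-> exists v d, [/\ supported l v (l v), strict_anc f v d & l v < l d].
Proof.
have sigma_lt' : all (ltn^~ r') sigma.
  by apply: sub_all sigma_lt => x /ltn_trans; apply.
apply: iff_trans (exists_occ _ _) _.
split=> [[vs H]|[v [d [[vs [ovs avs lvs]] vd lvd]]]].
  have [vs1 [d evs]] := occ_rconsE H; rewrite {}evs occ_rcons in H.
  case/andP: H => H; have [vs0 [v evs]] := occ_rconsE H; rewrite {}evs in H *.
  move: H; rewrite occ_rcons_max // => /and3P[ovs avs lvs].
  have [/eqP sz _] := andP ovs; rewrite zip_rcons // all_rcons => /andP[].
  case/and3P=> /= vd; rewrite rr' => /eqP lvd _ _.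
  by exists v, d; split=> //; exists vs0.
exists (rcons (rcons vs v) d); have [/eqP sz _] := andP ovs.
rewrite occ_rcons occ_rcons_max // ovs avs lvs zip_rcons // all_rcons /=.
rewrite all_pair_occ_max // /pair_occ /= vd lvd rr' ltnNge (ltnW lvd).
rewrite ltnNge (ltnW rr') /=; apply/andP; split; apply/allP => u uvs.
  exact: strict_anc_trans (allP avs u uvs) vd.
exact: ltn_trans (allP lvs u uvs) lvd.
Qed.

(** The last label lies above those of the witness and below [l v], which says that [v] would stay
    special with this smaller label. *)
Lemma occ_between l :
  [exists vs : (size (rcons (rcons sigma r') r)).-tuple 'I_n, instance_of f l vs]
  <-> exists v d, [/\ supported l v (l d), strict_anc f v d & l d < l v].
Proof.
have sigma_lt' : all (ltn^~ r') sigma.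
  by apply: sub_all sigma_lt => x /ltn_trans; apply.
apply: iff_trans (exists_occ _ _) _.
split=> [[vs H]|[v [d [[vs [ovs avs lvs]] vd lvd]]]].
  have [vs1 [d evs]] := occ_rconsE H; rewrite {}evs occ_rcons in H.
  case/andP: H => H; have [vs0 [v evs]] := occ_rconsE H; rewrite {}evs in H *.
  move: H; rewrite occ_rcons_max // => /and3P[ovs avs lvs].
  have [/eqP sz _] := andP ovs; rewrite zip_rcons // all_rcons => /andP[].
  case/and3P=> /= vd _; rewrite rr' => /eqP lvd.
  rewrite all_pair_occ_max // => /andP[_ lds].
  by exists v, d; split=> //; exists vs0.
exists (rcons (rcons vs v) d); have [/eqP sz _] := andP ovs.
rewrite occ_rcons occ_rcons_max // ovs avs zip_rcons // all_rcons /=.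
rewrite all_pair_occ_max // lvs /pair_occ /= vd lvd rr' ltnNge (ltnW lvd).
rewrite ltnNge (ltnW rr') /= andbT; apply/andP; split; apply/allP => u uvs.
  exact: ltn_trans (allP lvs u uvs) lvd.
exact: strict_anc_trans (allP avs u uvs) vd.
Qed.

End Patterns.

Lemma occ_213 n (f : parents n) (l : 'I_n -> 'I_n) :
  [exists vs : (size pat213).-tuple 'I_n, instance_of f l vs] <->
  exists a b c, [/\ strict_anc f a b, strict_anc f b c & l b < l a < l c].
Proof.
apply: iff_trans (exists_occ _ _ _) _.
split=> [[[|a [|b [|c [|? ?]]]] //]|[a [b [c [ab bc /andP[lba lac]]]]]].
  rewrite /occ /pair_occ /= !andbT.
  case/andP => /andP[/and3P[ab _ /eqP lba] /and3P[ac /eqP lac _]] /andP[bc _].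
  by exists a, b, c; rewrite lba lac.
exists [:: a; b; c]; rewrite /occ /pair_occ /= !andbT.
by rewrite ab bc (strict_anc_trans ab bc) /=; lia.
Qed.

Lemma eq_in_occ n (f : parents n) (l1 l2 : 'I_n -> 'I_n) rho vs :
  {in vs, l1 =1 l2} -> occ f l1 rho vs = occ f l2 rho vs.
Proof.
rewrite /occ; case: eqP => //= _; elim: vs rho => [|v vs IHvs] [|x rho] //= e12.
rewrite IHvs => [|u us]; last by rewrite e12 // inE us orbT.
congr (_ && _); apply: eq_in_all => p /(map_f fst) pvs.
rewrite /pair_occ /= !e12 ?inE ?eqxx //; apply/orP; right.
(* First components of [zip vs rho] lie in [vs] whatever the two lengths are; the size equation was
   dropped before the induction. *)
by elim: vs rho p.1 pvs {IHvs e12} => [|a s IHs] [|b t] //= z; rewrite !inE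
  => /orP[->|/IHs->]; rewrite ?orbT.
Qed.

(** * Effect of a relabeling on special vertices *)

Section Relabeling.
Variables (n : nat) (f : parents n) (sigma : seq nat) (r : nat).
Hypotheses (hf : is_forest f) (sigma_lt : all (ltn^~ r) sigma)
  (sigma_neq0 : sigma != [::]).
Implicit Types (l : 'I_n -> 'I_n) (u v w d : 'I_n).

Let anc := strict_anc f.
Let supp := supported f sigma.
Let rho := rcons sigma r.

(** For injective labelings, this at all vertices amounts to avoiding [sigma] followed by [r] and a
    larger entry. The form by vertices allows it to be required on a part of the forest only. *)
Definition special_top l v : Prop :=
  special rho f l v -> forall d, anc v d -> l d < l v.

(** The counterpart for the pattern with its last two entries exchanged. *)
Definition special_bottom l v : Prop :=
  special rho f l v -> forall d, anc v d -> l d < l v -> ~ supp l v (l d).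

Lemma supported_anc l v w x : anc v w -> supp l v x -> supp l w x.
Proof.
move=> vw [vs [ovs avs lvs]]; exists vs; split=> //.
by apply: sub_all avs => u uv; apply: strict_anc_trans vw.
Qed.

Lemma supported_subtree l v w x : w \in subtree f v -> supp l v x -> supp l w x.
Proof. by case/subtreeE => [->|/supported_anc]; last exact. Qed.

(** Witnesses consist of strict ancestors of [v], so no other label is read. *)
Lemma eq_supported l1 l2 v x :
  (forall u, anc u v -> l1 u = l2 u) -> supp l1 v x <-> supp l2 v x.
Proof.
have H k1 k2 : (forall u, anc u v -> k1 u = k2 u) -> supp k1 v x -> supp k2 v x.
  move=> e [vs [ovs avs lvs]]; exists vs.
  have e' : {in vs, k1 =1 k2} by move=> u /(allP avs); apply: e.
  rewrite -(eq_in_occ _ _ e'); split=> //.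
  by apply/allP => u us; rewrite -e' // (allP lvs).
by move=> e; split; apply: H => // u /e.
Qed.

(* A witness for [w] that contains an altered label can be replaced by a
   witness for [v]. *)
Lemma special_transfer l1 l2 v w :
    (forall u, u \notin subtree f v -> l1 u = l2 u) ->
    (forall u, u \in subtree f v ->
       l1 u = l2 u \/ supp l2 v (l1 u) /\ supp l2 v (l2 u)) ->
  special rho f l1 w -> special rho f l2 w.
Proof.
move=> out cases /(specialP _ sigma_lt) s1; apply/(specialP _ sigma_lt).
case: (boolP (w \in subtree f v)) => ws; last first.
  have e u : anc u w -> l2 u = l1 u.
    move=> uw; apply/esym/out.
    by apply: contra ws => us; apply/subtree_strict/(subtree_strict_anc us uw).
  by rewrite -out //; apply/(eq_supported _ e).
(* If the label of [w] changed, its new label is supported at [v] and hence at [w] below. *)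
case: (cases _ ws) => [ew|[_]]; last exact: supported_subtree ws.
rewrite -ew; have [vs [ovs avs lvs]] := s1.
case: (boolP (all (fun u => l1 u == l2 u) vs)) => [/allP eqs|/allPn[u us neu]].
  have eqs' : {in vs, l1 =1 l2} by move=> u /eqs/eqP.
  exists vs; rewrite -(eq_in_occ _ _ eqs'); split=> //.
  by apply/allP => u us; rewrite -eqs' // (allP lvs).
have uv : u \in subtree f v by apply: contraNT neu => /out->.
case: (cases _ uv) => [eu|[slu _]]; first by rewrite eu eqxx in neu.
by apply: supported_subtree ws _; apply: supportedW slu (ltnW (allP lvs u us)).
Qed.

Section Step.
Variables (l : 'I_n -> 'I_n) (v y : 'I_n).
Hypotheses (linj : injective l) (yL : y \in label_set f l v).
Hypotheses (sv : special rho f l v) (svy : supp l v y).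
Let l' := relabel_subtree f l v y.

(** Both [l v] and [y] are supported at [v], hence so is their minimum, and a label that moves is at
    least this minimum before and after. *)
Lemma relabel_supported_cases u : u \in subtree f v ->
  l' u = l u \/ supp l v (l u) /\ supp l v (l' u).
Proof.
move=> us; have svm : supp l v (minn (l v) y).
  have /(specialP _ sigma_lt) := sv; rewrite /minn; by case: ifP.
case: (relabel_interval hf linj yL us); first by left.
by case=> /andP[lu _] /andP[l'u _]; right; split; apply: supportedW svm _.
Qed.

(** No strict ancestor of such a [w] lies in the subtree of [v]. *)
Lemma relabel_supported w x : (w == v) || (w \notin subtree f v) ->
  supp l' w x <-> supp l w x.
Proof.
move=> H; apply: eq_supported => u uw; apply: relabel_out; apply/negP => uv.
have vw := subtree_strict_anc uv uw.
case/orP: H => [/eqP e|]; first by rewrite e /anc strict_ancxx in vw.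
by rewrite (subtree_strict vw).
Qed.

Lemma relabel_supported_top x : supp l' v x <-> supp l v x.
Proof. by apply: relabel_supported; rewrite eqxx. Qed.

(** The transfer applies in both directions, support at [v] being the same under [l] and [l']. *)
Lemma relabel_special w : special rho f l' w = special rho f l w.
Proof.
have cases u : u \in subtree f v ->
    l' u = l u \/ supp l' v (l u) /\ supp l' v (l' u).
  case/relabel_supported_cases => [->|[slu sl'u]]; first by left.
  by right; split; exact/relabel_supported_top.
apply/idP/idP; apply: (@special_transfer _ _ v) => u.
- exact: relabel_out.
- by case/relabel_supported_cases => [->|[? ?]]; [left|right].
- by move=> us; rewrite /l' relabel_out.
- by case/cases => [->|[? ?]]; [left|right].
Qed.

(** Either [w] is strictly below [v], where relative order is kept, or its subtree is disjoint from
    that of [v]. *)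
Lemma relabel_special_top w :
  w != v -> ~~ anc w v -> special_top l w -> special_top l' w.
Proof.
move=> wv nwv tw; rewrite /special_top relabel_special => sw d wd.
case: (boolP (w \in subtree f v)) => [/subtreeE[e|vw]|ws].
- by rewrite e eqxx in wv.
- by rewrite /l' relabel_lt ?tw //; apply: strict_anc_trans wd.
have ds : d \notin subtree f v.
  apply/negP => /(strict_anc_subtree_cases wd)[|wv']; first exact/negP.
  by rewrite /anc wv' in nwv.
by rewrite /l' !relabel_out // tw.
Qed.

(** If [w] is above [v], its subtree has the same label set as before, so the old condition is
    applied to the former bearer of the label of [d]. *)
Lemma relabel_special_bottom w :
  w \notin subtree f v -> special_bottom l w -> special_bottom l' w.
Proof.
move=> ws bw; rewrite /special_bottom relabel_special => sw d wd.
rewrite {2 4}/l' [relabel_subtree _ _ _ _ w]relabel_out // => ld.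
move/relabel_supported; rewrite ws orbT => /(_ isT).
case: (boolP (d \in subtree f v)) => ds; last first.
  by rewrite /l' relabel_out // in ld *; apply: bw.
have [e|wv] := strict_anc_subtree_cases wd ds; first by rewrite e in ws.
have : l' d \in l' @: subtree f w by rewrite imset_f // subtree_strict.
rewrite relabel_image ?subtreeS ?(subtree_strict wv) // => /imsetP[d' wd' e].
move: ld; rewrite -/l' e => ld; apply: bw => //.
by case/subtreeE: wd' => // e'; rewrite e' ltnn in ld.
Qed.

End Step.

End Relabeling.

(** * Shuffling and antishuffling one vertex *)

Definition shuffle_step n (rho : seq nat) (f : parents n) (l : 'I_n -> 'I_n) v :=
  if special rho f l v then shuffle f l v else l.

Definition antishuffle_step n (rho : seq nat) (f : parents n)
    (l : 'I_n -> 'I_n) v :=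
  if special rho f l v then antishuffle rho f l v else l.

Section Traversal.
Variables (n : nat) (f : parents n) (sigma : seq nat) (r : nat).
Hypotheses (hf : is_forest f) (sigma_lt : all (ltn^~ r) sigma)
  (sigma_neq0 : sigma != [::]).
Implicit Types (l : 'I_n -> 'I_n) (u v w d : 'I_n) (A : pred 'I_n).

Let anc := strict_anc f.
Let supp := supported f sigma.
Let rho := rcons sigma r.
Let sh := shuffle_step rho f.
Let ash := antishuffle_step rho f.

Lemma shuffleE l v : exists y, [/\ shuffle f l v = relabel_subtree f l v y,
  y \in label_set f l v & forall z, z \in label_set f l v -> z <= y].
Proof.
rewrite /shuffle; case: arg_maxnP; first exact: label_set_in (subtree_id f v).
by move=> y yL ymax; exists y.
Qed.

(** A tentative label at [v] leaves its strict ancestors alone, so staying special with label [y]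
    means that [y] is supported at [v]. *)
Lemma antishuffleE l v : special rho f l v -> exists y,
  [/\ antishuffle rho f l v = relabel_subtree f l v y, y \in label_set f l v,
      supp l v y & forall z, z \in label_set f l v -> supp l v z -> y <= z].
Proof.
have specialE y : special rho f [eta l with v |-> y] v <-> supp l v y.
  apply: iff_trans (specialP _ sigma_lt _ _) _; rewrite /= eqxx.
  apply: eq_supported => u uv /=.
  by rewrite (negPf (strict_anc_neq hf uv)).
move=> /(specialP _ sigma_lt) sv; rewrite /antishuffle; case: arg_minnP.
  by rewrite label_set_in ?subtree_id //; apply/specialE.
move=> y /andP[yL /specialE sy] ymin; exists y; split=> // z zL /specialE sz.
by apply: ymin; rewrite zL.
Qed.

(* [A] is the set of vertices that [alpha] has visited, or that [beta] has not
   visited yet. *)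
Definition traversal_inv A l : Prop :=
  [/\ injective l, avoids213 f l, forall v, A v -> special_top f sigma r l v
    & forall v, ~~ A v -> special_bottom f sigma r l v].

Definition down_closed A : Prop := forall u d, A u -> anc u d -> A d.

(** Reduces each cancellation to showing that the second step chooses the old label of [v]. *)
Lemma eq_relabel_back l v y z : injective l -> y \in label_set f l v ->
  z = l v -> relabel_subtree f (relabel_subtree f l v y) v z = l.
Proof. by move=> linj yL ->; apply: relabelK. Qed.

Section Steps.
Variables (A : pred 'I_n) (v : 'I_n).
Hypothesis Av : ~~ A v.
(** A shuffle at [v] leads from [A] to [A'], an antishuffle from [A'] to [A]. Closure puts the
    strict descendants of [v] in [A] and its strict ancestors outside. *)
Let A' : pred 'I_n := fun u => (u == v) || A u.
Hypotheses (A_down : down_closed A) (A'_down : down_closed A').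

Let desc_A d : anc v d -> A d.
Proof.
move=> vd; have := A'_down _ vd; rewrite /A' /= !eqxx => /(_ isT).
by case/predU1P => // e; rewrite e /anc strict_ancxx in vd.
Qed.

Let anc_notA p : anc p v -> ~~ A p.
Proof. by move=> pv; apply: contra Av => /A_down; apply. Qed.

Let notA_subtree w : ~~ A w -> w != v -> w \notin subtree f v.
Proof.
by move=> nAw wv; rewrite inE negb_or wv; apply: contra nAw; apply: desc_A.
Qed.

(** The maximal label at [v] gives the top condition there and excludes a 213 starting at [v]; the
    remaining conditions are carried over by the relabeling lemmas. *)
Lemma shuffle_inv l : traversal_inv A l -> traversal_inv A' (sh l v).
Proof.
move=> [linj l213 ltop lbot]; rewrite /sh /shuffle_step; case: ifP => sv; last first.
  split=> // w; first by case/predU1P => [-> |/ltop//]; rewrite /special_top sv.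
  by rewrite /A' /= negb_or => /andP[_ /lbot].
have [y [-> yL ymax]] := shuffleE l v.
have lvy : l v <= y by apply: ymax; apply: label_set_in (subtree_id f v).
have svy : supp l v y.
  by move/(specialP _ sigma_lt): sv => /supportedW; apply.
have l'in u : u \in subtree f v -> relabel_subtree f l v y u <= y.
  by move=> us; apply: ymax; apply: relabel_label_in.
split.
- exact: relabel_inj.
- apply: relabel_avoids213 => // [p pv|q t vq qt].
    (* Let [u] bear the label [y]. An ancestor [p] with a label between [l v] and [y] would make
       [p], [v], [u] a 213. *)
    have [u us ey] := imsetP yL.
    apply/negP; rewrite (minn_idPl lvy) (maxn_idPr lvy) => /andP[vp py].
    have nvp : l p != l v :> nat.
      by apply/eqP => /val_inj/linj e; rewrite e /anc strict_ancxx in pv.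
    case/subtreeE: (us) => [euv|vu].
      by rewrite ey euv in py; lia.
    have nup : l p != l u :> nat.
      apply/eqP => /val_inj/linj e; rewrite e in pv.
      by have := strict_anc_trans pv vu; rewrite strict_ancxx.
    by have := l213 _ _ _ pv vu; rewrite ey in py; lia.
  apply/negP => /andP[_]; rewrite ltnNge l'in //.
  exact: subtree_strict (strict_anc_trans vq qt).
- move=> w /predU1P[->|Aw].
    move=> _ d vd; rewrite relabel_top ltn_neqAle l'in ?subtree_strict // andbT.
    apply/eqP => e; have := relabel_top f v l y; rewrite -{2}(val_inj e).
    move/(relabel_inj hf linj yL) => evd.
    by rewrite evd /anc strict_ancxx in vd.
  apply: (relabel_special_top hf sigma_lt linj yL sv svy) => //; last exact: ltop.
    by apply: contraNneq Av => <-.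
  by apply: contra Av; apply: A_down.
move=> w; rewrite /A' /= negb_or => /andP[wv nAw].
by apply: (relabel_special_bottom hf sigma_lt linj yL sv svy) => //; [apply: notA_subtree|apply: lbot].
Qed.

(** Minimality of [y] gives the bottom condition at [v]. The avoidance of 213 is the delicate part:
    it uses a witness for [y] and the bottom condition at the strict ancestors of [v]. *)
Lemma antishuffle_inv l : traversal_inv A' l -> traversal_inv A (ash l v).
Proof.
move=> [linj l213 ltop lbot]; rewrite /ash /antishuffle_step.
case: ifP => sv; last first.
  split=> // w Aw; first by apply: ltop; rewrite /A' /= Aw orbT.
  have [->|wv] := eqVneq w v; first by rewrite /special_bottom sv.
  by apply: lbot; rewrite /A' /= negb_or wv.
have [y [-> yL svy ymin]] := antishuffleE sv.
have vtop d : d \in subtree f v -> l d <= l v.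
  case/subtreeE => [->//|vd]; apply/ltnW/ltop => //; by rewrite /A' /= eqxx.
have [dy dyv ey] := imsetP yL.
have yv : y <= l v by rewrite ey vtop.
have l'in u : u \in subtree f v -> relabel_subtree f l v y u \in label_set f l v.
  by move=> us; apply: relabel_label_in.
split.
- exact: relabel_inj.
- apply: relabel_avoids213 => // [p pv|q t vq qt].
    rewrite (minn_idPr yv) (maxn_idPl yv); apply/negP => /andP[yp pv_le].
    have nvp : l p != l v :> nat.
      by apply/eqP => /val_inj/linj e; rewrite e /anc strict_ancxx in pv.
    have pdy := strict_anc_subtree pv dyv.
    have npdy : l p != l dy :> nat.
      by apply/eqP => /val_inj/linj e; rewrite e strict_ancxx in pdy.
    (* With e the last vertex of a witness vs for y: if p is above e then p, e, v
       is a 213; if p is below e then p is special and y contradicts the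
       minimality of its label. *)
    have [vs [ovs avs lvs]] := svy.
    have [vs0 [e evs]] : exists vs0 e, vs = rcons vs0 e.
      case/andP: ovs => /eqP/esym sz _; case/lastP: vs sz {avs lvs} => [sz|vs0 e _].
        by move: sigma_neq0; rewrite -size_eq0 sz.
      by exists vs0, e.
    have evs_in : e \in vs by rewrite evs mem_rcons mem_head.
    have ev := allP avs e evs_in; have ly := allP lvs e evs_in.
    case: (strict_anc_total pv ev) => [epe|pe|ep].
    + by rewrite epe leqNgt ly in yp.
    + by have := l213 _ _ _ pe ev; rewrite (leq_trans ly yp) ltn_neqAle nvp pv_le.
    (* The vertices of a witness form a chain, so all of them lie above [p] once the last one, [e],
       does. *)
    have sp : supp l p y.
      exists vs; split=> //; rewrite evs all_rcons ep /=; apply/allP => u us.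
      move: ovs; rewrite /occ evs => /andP[/eqP sz]; case/lastP: sigma sz => [|s x].
        by rewrite size_rcons.
      rewrite !size_rcons => -[sz]; rewrite zip_rcons // pairwise_rcons.
      case/andP => /allP H _; have : u \in unzip1 (zip vs0 s) by rewrite unzip1_zip ?sz.
      by case/mapP => q /H /and3P[/= qe _ _] ->; apply: strict_anc_trans ep.
    have nA'p : ~~ A' p.
      rewrite /A' /= negb_or anc_notA // andbT.
      by apply: contraTneq pv => ->; rewrite /anc strict_ancxx.
    have spp : special rho f l p.
      by apply/(specialP _ sigma_lt); apply: supportedW sp yp.
    apply: (lbot _ nA'p spp _ pdy); last by rewrite -ey.
    by rewrite ltn_neqAle eq_sym npdy -ey.
  apply/negP => /andP[qy yt].
  have vt := strict_anc_trans vq qt.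
  (* A label of the subtree smaller than [y] is not supported at [v], so the label of [q] cannot
     have moved. *)
  have nsq : ~ supp l v (relabel_subtree f l v y q).
    by move/(ymin _ (l'in _ (subtree_strict vq))); lia.
  have eq' : relabel_subtree f l v y q = l q.
    case: (relabel_supported_cases hf sigma_lt linj yL sv svy (subtree_strict vq)) => // -[_].
    by move/nsq.
  (* Some u in a witness for y lies above l q, and then u, q, t is a 213. *)
  have [vs [ovs avs lvs]] := svy.
  have [u us qu] : exists2 u, u \in vs & l q <= l u.
    apply/hasP; apply/negPn; rewrite -all_predC; apply/negP => H.
    apply: nsq; rewrite eq'; exists vs; split=> //.
    by apply: sub_all H => u /=; rewrite -ltnNge.
  have uv := allP avs u us; have uy := allP lvs u us.
  have uq := strict_anc_trans uv vq.
  have nuq : l u != l q :> nat.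
    by apply/eqP => /val_inj/linj e; rewrite e strict_ancxx in uq.
  (* Either the label of [t] did not move, or it lay in the interval whose lower end is [y]. *)
  have yt' : y <= l t.
    have [<-|[/andP[]]] := relabel_interval hf linj yL (subtree_strict vt).
      exact: ltnW.
    by rewrite (minn_idPr yv).
  by have := l213 _ _ _ uq qt; rewrite (leq_trans uy yt') ltn_neqAle eq_sym nuq qu.
- move=> w Aw; have wv : w != v by apply: contraNneq Av => <-.
  apply: (relabel_special_top hf sigma_lt linj yL sv svy) => //; last by apply: ltop; rewrite /A' /= Aw orbT.
  by apply: contra Av; apply: A_down.
move=> w nAw; have [->|wv] := eqVneq w v.
  move=> _ d vd; rewrite relabel_top => dy_lt sd.
  have svd : supp l v (relabel_subtree f l v y d).
    by apply/(relabel_supported_top sigma hf l v y).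
  by have := ymin _ (l'in _ (subtree_strict vd)) svd; rewrite leqNgt dy_lt.
apply: (relabel_special_bottom hf sigma_lt linj yL sv svy) => //; first exact: notA_subtree.
by apply: lbot; rewrite /A' /= negb_or wv.
Qed.

(** The shuffle changes neither the label set nor the support at [v], and by the bottom condition
    [l v] is the least supported label there. *)
Lemma shuffleK l : traversal_inv A l -> ash (sh l v) v = l.
Proof.
move=> [linj l213 ltop lbot]; rewrite /sh /shuffle_step; case: ifP => sv; last first.
  by rewrite /ash /antishuffle_step sv.
have [y [-> yL ymax]] := shuffleE l v.
have lvy : l v <= y by apply: ymax; apply: label_set_in (subtree_id f v).
have svv : supp l v (l v) by exact/(specialP _ sigma_lt).
have svy : supp l v y by apply: supportedW svv _.
have sv' : special rho f (relabel_subtree f l v y) v by rewrite (relabel_special hf sigma_lt).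
rewrite /ash /antishuffle_step sv'.
have [z [-> zL svz zmin]] := antishuffleE sv'.
rewrite relabel_label_set // in zL zmin.
apply: eq_relabel_back => //; apply/val_inj/eqP; rewrite eqn_leq /=.
have suppE := relabel_supported_top sigma hf l v y.
rewrite zmin ?label_set_in ?subtree_id //=; last exact/suppE.
rewrite leqNgt; apply/negP => zlv.
have [d /subtreeE[ed|vd] ez] := imsetP zL; first by rewrite ez ed ltnn in zlv.
have := lbot v Av sv d vd; rewrite -ez => /(_ zlv); apply; exact/suppE.
Qed.

(** By the top condition [l v] is the maximum of the label set, which the antishuffle leaves
    unchanged. *)
Lemma antishuffleK l : traversal_inv A' l -> sh (ash l v) v = l.
Proof.
move=> [linj l213 ltop lbot]; rewrite /ash /antishuffle_step.
case: ifP => sv; last by rewrite /sh /shuffle_step sv.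
have [y [-> yL svy ymin]] := antishuffleE sv.
rewrite /sh /shuffle_step relabel_special // sv.
have [z [-> zL zmax]] := shuffleE (relabel_subtree f l v y) v.
rewrite relabel_label_set // in zL zmax.
apply: eq_relabel_back => //; apply/val_inj/eqP; rewrite eqn_leq /=.
rewrite zmax ?label_set_in ?subtree_id // andbT.
have [d /subtreeE[->|vd] ->] := imsetP zL => //.
by apply/ltnW/ltop => //; rewrite /A' /= eqxx.
Qed.

End Steps.

End Traversal.

(** * Traversal orders *)

(** The head of [s] is unrelated by [R] to everything that precedes it in [t], so it commutes to the
    front of [t]; then induction applies to the rest. *)
Lemma foldr_linear_extension (T : eqType) (S : Type) (R : rel T)
    (op : T -> S -> S) (z : S) (s t : seq T) :
    (forall x y a, ~~ R x y -> ~~ R y x -> op x (op y a) = op y (op x a)) ->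
    perm_eq s t -> pairwise (fun x y => ~~ R y x) s ->
    pairwise (fun x y => ~~ R y x) t ->
  foldr op z s = foldr op z t.
Proof.
move=> comm; elim: s t => [|x s IHs] t st /=; first by move: st; rewrite perm_sym => /perm_nilP->.
case/andP => /allP xs ps pt.
have xt : x \in t by rewrite -(perm_mem st) mem_head.
case/splitPr: xt st pt => t1 t2; rewrite perm_sym -[x :: t2]cat1s.
rewrite perm_catCA cat1s perm_cons perm_sym.
move=> st; rewrite pairwise_cat => /and3P[/allrelP R12 p1 /=/andP[_ p2]].
rewrite (IHs _ st ps); last first.
  rewrite pairwise_cat p1 p2 andbT; apply/andP; split=> //; apply/allrelP => a b at1 bt2.
  by apply: R12 => //; rewrite inE bt2 orbT.
have {}st : {subset t1 <= s} by move=> a; rewrite (perm_mem st) mem_cat => ->.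
have {}R12 a : a \in t1 -> ~~ R x a by move=> /R12; apply; apply: mem_head.
rewrite !foldr_cat /=; elim: t1 st R12 {p1 IHs} => //= a t1 IH1 st R12.
rewrite -IH1; first by apply: comm; [apply: R12; apply: mem_head|apply: xs; apply: st; apply: mem_head].
  by move=> b bt; apply: st; rewrite inE bt orbT.
by move=> b bt; apply: R12; rewrite inE bt orbT.
Qed.

Section Orders.
Variables (n : nat) (f : parents n) (sigma : seq nat) (r : nat).
Hypotheses (hf : is_forest f) (sigma_lt : all (ltn^~ r) sigma)
  (sigma_neq0 : sigma != [::]).
Implicit Types (l : 'I_n -> 'I_n) (u v w d : 'I_n) (s : seq 'I_n).

Let anc := strict_anc f.
Let rho := rcons sigma r.
Let sh := shuffle_step rho f.
Let ash := antishuffle_step rho f.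
Let inv := traversal_inv f sigma r.

Lemma shuffle_step_out l v u : u \notin subtree f v -> sh l v u = l u.
Proof.
by move=> us; rewrite /sh /shuffle_step; case: ifP => // _; apply: relabel_out.
Qed.

(** A step at [v] reads the strict ancestors, to decide whether [v] is special, and the subtree, to
    relabel it. *)
Lemma shuffle_step_local l1 l2 v :
    (forall u, u \in subtree f v \/ anc u v -> l1 u = l2 u) ->
  forall u, u \in subtree f v -> sh l1 v u = sh l2 v u.
Proof.
move=> e u us; have ev : l1 v = l2 v by apply: e; left; apply: subtree_id.
rewrite /sh /shuffle_step.
have -> : special rho f l1 v = special rho f l2 v.
  have sE x : supported f sigma l1 v x <-> supported f sigma l2 v x.
    by apply: eq_supported => w wv; apply: e; right.
  by apply/idP/idP => /(specialP _ sigma_lt) H; apply/(specialP _ sigma_lt);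
    move: H; rewrite ev => /sE.
case: ifP => _; last by apply: e; left.
have eL : label_set f l1 v = label_set f l2 v.
  by apply: eq_in_imset => w ws; apply: e; left.
by rewrite /shuffle /relabel_subtree eL ev (e u) //; left.
Qed.

(** For incomparable vertices, the subtree and the ancestors of one avoid the subtree of the other,
    so neither step reads what the other writes. *)
Lemma shuffle_stepC l x y : ~~ anc x y -> ~~ anc y x ->
  sh (sh l y) x = sh (sh l x) y.
Proof.
have [-> //|xy nxy nyx] := eqVneq x y.
have incomp a b u : a != b -> ~~ anc a b -> ~~ anc b a ->
    u \in subtree f a \/ anc u a -> u \notin subtree f b.
  move=> ab nab nba; rewrite -[_ \/ _]/(_ \/ strict_anc f u a) => ua.
  apply/negP => ub.
  have [] : a \in subtree f b \/ b \in subtree f a.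
    case: ua => [ua|ua]; first exact: subtree_total ua ub.
    by left; apply/subtree_strict; apply: subtree_strict_anc ua.
  - by case/subtreeE => [e|]; [rewrite e eqxx in ab|apply/negP].
  - by case/subtreeE => [e|]; [rewrite e eqxx in ab|apply/negP].
have yx : y != x by rewrite eq_sym.
apply: functional_extensionality => u.
have [ux|ux] := boolP (u \in subtree f x).
  have uy : u \notin subtree f y by apply: (incomp x); first exact; [|exact|left].
  rewrite [RHS]shuffle_step_out //; apply: shuffle_step_local => // w /(incomp _ y).
  by move=> H; apply: shuffle_step_out; apply: H.
rewrite shuffle_step_out //.
have [uy|uy] := boolP (u \in subtree f y); last by rewrite !shuffle_step_out.
apply/esym; apply: shuffle_step_local => // w /(incomp _ x).
by move=> H; apply: shuffle_step_out; apply: H.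
Qed.

Let before := fun u v => ~~ anc v u.

Let down_closed_behead x s : all (before x) s ->
  down_closed f (fun u => u \in x :: s) -> down_closed f (fun u => u \in s).
Proof.
move=> /allP xs Ds u d us ud; have := Ds u d.
rewrite /= !inE us orbT => /(_ isT ud)/predU1P[e|//].
by have := xs u us; rewrite /before -e /anc ud.
Qed.

(** [foldr] shuffles the head of [s] last, and [foldl] antishuffles it first, so the steps cancel
    from the inside out. *)
Lemma shuffle_traversal s l : uniq s -> pairwise before s ->
    down_closed f (fun u => u \in s) -> inv pred0 l ->
  let l' := foldr (fun v l => sh l v) l s in
  inv (fun u => u \in s) l' /\ foldl ash l' s = l.
Proof.
elim: s => [|x s IHs] //= /andP[xs us] /andP[bxs bs] Ds il.
have Ds' := down_closed_behead bxs Ds.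
have [il' e] := IHs us bs Ds' il.
split; first exact: (shuffle_inv hf sigma_lt sigma_neq0 xs Ds' Ds il').
by rewrite /ash /sh (shuffleK hf sigma_lt xs il').
Qed.

Lemma antishuffle_traversal s l : uniq s -> pairwise before s ->
    down_closed f (fun u => u \in s) -> inv (fun u => u \in s) l ->
  let l' := foldl ash l s in
  inv pred0 l' /\ foldr (fun v l => sh l v) l' s = l.
Proof.
elim: s l => [|x s IHs] l //= /andP[xs us] /andP[bxs bs] Ds il.
have Ds' := down_closed_behead bxs Ds.
have il' : inv (fun u => u \in s) (ash l x).
  exact: (antishuffle_inv hf sigma_lt sigma_neq0 xs Ds' Ds il).
have [il0 e] := IHs _ us bs Ds' il'.
split=> //; rewrite e.
by rewrite /ash /sh (antishuffleK hf sigma_lt il).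
Qed.

End Orders.

(** * Renaming vertices by their labels *)

Section Renaming.
Variables (n : nat) (f : parents n) (h : 'I_n -> 'I_n).
Hypothesis hinj : injective h.
Implicit Types (l : 'I_n -> 'I_n) (u v d : 'I_n).

Let g := named_by f h.
Let hK : cancel h (finv h) := finv_f hinj.
Let h'K : cancel (finv h) h := f_finv hinj.

Lemma named_by_parent v : g (h v) = omap h (f v).
Proof. by rewrite ffunE hK. Qed.

Lemma named_by_anc u v : strict_anc g (h u) (h v) = strict_anc f u v.
Proof.
(* Stated for any map that commutes with parents, to be used for [h] and for its inverse. *)
have transfer (f1 f2 : parents n) (k : 'I_n -> 'I_n) a b :
    (forall w, f2 (k w) = omap k (f1 w)) ->
    strict_anc f1 a b -> strict_anc f2 (k a) (k b).
  move=> e /existsP[w /andP[/eqP bw /connectP[p pth ->]]].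
  apply/existsP; exists (k w); rewrite e bw eqxx /=.
  apply/connectP; exists (map k p); last by rewrite last_map.
  rewrite path_map; apply: sub_path pth => c d /= /eqP cd.
  by rewrite e cd.
apply/idP/idP; last exact/transfer/named_by_parent.
rewrite -{2}[u]hK -{2}[v]hK; apply: transfer => w.
by rewrite -{2}[w]h'K named_by_parent; case: (f _) => //= a; rewrite hK.
Qed.

Lemma named_by_forest : is_forest f -> is_forest g.
Proof.
by move/forallP => hf; apply/forallP => v; rewrite -[v]h'K named_by_anc.
Qed.

Lemma named_by_instance l rho (vs : (size rho).-tuple 'I_n) :
  instance_of g l (map_tuple h vs) = instance_of f (l \o h) vs.
Proof.
by apply: eq_forallb => a; apply: eq_forallb => b; rewrite !tnth_map named_by_anc.
Qed.

Let map_hK (m : nat) (vs : m.-tuple 'I_n) :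
  map_tuple h (map_tuple (finv h) vs) = vs.
Proof. by apply: val_inj; rewrite /= mapK. Qed.

(** Avoidance by the renamed forest becomes a property of the labeling [h] on the original
    vertices. *)
Lemma avoids_named_by rho : avoids g rho =
  ~~ [exists vs : (size rho).-tuple 'I_n, instance_of f h vs].
Proof.
congr negb; apply/existsP/existsP => -[vs].
  by rewrite -[vs]map_hK named_by_instance; exists (map_tuple (finv h) vs).
by rewrite -[h]/(id \o h) -named_by_instance; exists (map_tuple h vs).
Qed.

Lemma named_by_special rho l v : special rho g l (h v) = special rho f (l \o h) v.
Proof.
apply/existsP/existsP => -[vs]; last first.
  rewrite -named_by_instance => /andP[vsi /eqP vsv].
  by exists (map_tuple h vs); rewrite vsi onth_map vsv /= eqxx.
rewrite -[vs]map_hK named_by_instance => /andP[vsi].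
rewrite -[tval (map_tuple h _)]/(map h _) onth_map; case E: onth => [w|//] /eqP[/hinj ewv].
by exists (map_tuple (finv h) vs); rewrite vsi E ewv /= eqxx.
Qed.

Lemma named_by_subtree v : subtree g (h v) = h @: subtree f v.
Proof.
apply/setP => u; rewrite -[u]h'K mem_imset // !inE named_by_anc.
by rewrite (inj_eq hinj).
Qed.

Lemma named_by_label_set l v : label_set g l (h v) = label_set f (l \o h) v.
Proof. by rewrite /label_set named_by_subtree [RHS]imset_comp. Qed.

Lemma named_by_relabel l v y :
  relabel_subtree g l (h v) y \o h = relabel_subtree f (l \o h) v y.
Proof.
apply: functional_extensionality => u; rewrite /relabel_subtree /=.
by rewrite (inj_eq hinj) named_by_anc named_by_label_set.
Qed.

Lemma named_by_shuffle_step rho l v :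
  shuffle_step rho g l (h v) \o h = shuffle_step rho f (l \o h) v.
Proof.
rewrite /shuffle_step named_by_special; case: ifP => // _.
by rewrite /shuffle named_by_relabel named_by_label_set.
Qed.

Lemma named_by_antishuffle_step rho l v :
  antishuffle_step rho g l (h v) \o h = antishuffle_step rho f (l \o h) v.
Proof.
rewrite /antishuffle_step named_by_special; case: ifP => // _.
rewrite /antishuffle named_by_relabel named_by_label_set; congr relabel_subtree.
congr (arg_min _ _ _); apply: functional_extensionality => y; rewrite named_by_special.
congr (_ && special _ _ _ _); apply: functional_extensionality => u /=.
by rewrite (inj_eq hinj).
Qed.

(** With [l] the identity, a traversal of the renamed forest becomes one of [f] that starts from the
    labeling [h]. *)
Lemma foldl_named_by (step_g step_f : ('I_n -> 'I_n) -> 'I_n -> 'I_n -> 'I_n)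
    l (s : seq 'I_n) :
    (forall l v, step_g l (h v) \o h = step_f (l \o h) v) ->
  foldl step_g l (map h s) \o h = foldl step_f (l \o h) s.
Proof. by move=> e; elim: s l => //= v s IHs l; rewrite IHs e. Qed.

Lemma named_by_ancestors_first (s : seq 'I_n) :
  ancestors_first g s -> ancestors_first f (map (finv h) s).
Proof.
case/andP => sp ss; apply/andP; split.
  apply: uniq_perm; rewrite ?enum_uniq //.
    rewrite map_inj_uniq ?(perm_uniq sp) ?enum_uniq //.
    exact: can_inj h'K.
  move=> u; rewrite mem_enum; apply/mapP; exists (h u); last by rewrite hK.
  by rewrite (perm_mem sp) mem_enum.
rewrite pairwise_map; apply: sub_pairwise ss => u v /=.
by rewrite -named_by_anc !h'K.
Qed.

Lemma named_byK (k : 'I_n -> 'I_n) : k \o h = id -> named_by g k = f.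
Proof.
move=> kh; have ek v : k (h v) = v by rewrite -[LHS]/((k \o h) v) kh.
have kinj : injective k by apply: (can_inj (g := h)) => v; rewrite -{1}[v]h'K ek h'K.
apply/ffunP => v; rewrite ffunE; have -> : finv k v = h v.
  by apply: (kinj); rewrite ek (f_finv kinj).
by rewrite named_by_parent; case: (f v) => //= w; rewrite ek.
Qed.

End Renaming.

(** * The bijection *)

Section Bijection.
Variables (n : nat) (sigma : seq nat) (r r' : nat).
Hypotheses (sigma_lt : all (ltn^~ r) sigma) (rr' : r < r')
  (sigma_neq0 : sigma != [::]).
Implicit Types (f : parents n) (l h : 'I_n -> 'I_n) (s t : seq 'I_n).

Let rho := rcons sigma r.

Definition occurs f l pat : bool :=
  [exists vs : (size pat).-tuple 'I_n, instance_of f l vs].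

Lemma avoids213P f l : avoids213 f l <-> ~~ occurs f l pat213.
Proof.
split=> [H|/negP H a b c ab bc].
  by apply/negP => /occ_213[a [b [c [ab bc]]]]; apply/negP/H.
by apply/negP => abc; apply: H; apply/occ_213; exists a, b, c.
Qed.

(** With every vertex in the set the bottom condition is vacuous, and a violation of the top
    condition is an occurrence as in [occ_above]. *)
Lemma traversal_inv_predT f l : is_forest f -> injective l ->
  traversal_inv f sigma r predT l <->
  ~~ occurs f l pat213 && ~~ occurs f l (rcons rho r').
Proof.
move=> hf linj; split=> [[_ /avoids213P-> ltop _] /=|/andP[H213 /negP H]].
  apply/negP => /(occ_above _ sigma_lt rr')[v [d [sv vd]]].
  by rewrite ltnNge ltnW // ltop //; apply/(specialP _ sigma_lt).
split=> //; first exact/avoids213P.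
move=> v _ /(specialP _ sigma_lt) sv d vd; rewrite ltnNge; apply/negP => vd'.
apply: H; apply/(occ_above _ sigma_lt rr'); exists v, d; split=> //.
rewrite ltn_neqAle vd' andbT; apply/eqP => /val_inj/linj e.
by rewrite e strict_ancxx in vd.
Qed.

(** Dually, the top condition is vacuous and a violation of the bottom one is an occurrence as in
    [occ_between]. *)
Lemma traversal_inv_pred0 f l : injective l ->
  traversal_inv f sigma r pred0 l <->
  ~~ occurs f l pat213 && ~~ occurs f l (rcons (rcons sigma r') r).
Proof.
move=> linj; split=> [[_ /avoids213P-> _ lbot] /=|/andP[H213 /negP H]].
  apply/negP => /(occ_between _ sigma_lt rr')[v [d [sd vd ld]]].
  apply: (lbot v isT _ d vd ld sd); apply/(specialP _ sigma_lt).
  exact: supportedW sd (ltnW ld).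
split=> //; first exact/avoids213P.
move=> v _ _ d vd ld sd; apply: H; apply/(occ_between _ sigma_lt rr').
by exists v, d.
Qed.

Lemma mem_ancestors_first f s : ancestors_first f s ->
  (fun u => u \in s) = predT.
Proof.
case/andP => /perm_mem sE _; apply: functional_extensionality => u.
by rewrite sE mem_enum.
Qed.

Lemma uniq_ancestors_first f s : ancestors_first f s -> uniq s.
Proof. by case/andP => /perm_uniq-> _; apply: enum_uniq. Qed.

Section Traversals.
Variables (f : parents n) (s t : seq 'I_n).
Hypotheses (hf : is_forest f) (hs : ancestors_first f s)
  (ht : ancestors_first f t).

Lemma foldr_shuffle_step_order l :
  foldr (fun v l => shuffle_step rho f l v) l s =
  foldr (fun v l => shuffle_step rho f l v) l t.
Proof.
case/andP: hs => ps bs; case/andP: ht => pt bt.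
apply: (@foldr_linear_extension _ _ (strict_anc f)) => // [x y a xy yx|].
  exact: (shuffle_stepC sigma_lt).
by rewrite (perm_trans ps) // perm_sym.
Qed.

Lemma shuffle_orders : traversal_inv f sigma r pred0 id ->
  let l := foldl (shuffle_step rho f) id (rev s) in
  traversal_inv f sigma r predT l /\ foldl (antishuffle_step rho f) l t = id.
Proof.
move=> inv_id /=; rewrite foldl_rev foldr_shuffle_step_order -(mem_ancestors_first ht).
apply: shuffle_traversal => //; first exact: uniq_ancestors_first ht.
  by case/andP: ht.
by rewrite (mem_ancestors_first ht).
Qed.

(** Only shuffles are reordered: those along [t] equal those along [s], which undo the antishuffles
    along [s]. *)
Lemma antishuffle_orders : traversal_inv f sigma r predT id ->
  let l := foldl (antishuffle_step rho f) id s in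
  traversal_inv f sigma r pred0 l /\ foldl (shuffle_step rho f) l (rev t) = id.
Proof.
rewrite -(mem_ancestors_first hs) => inv_id /=; rewrite foldl_rev -foldr_shuffle_step_order.
apply: antishuffle_traversal => //; first exact: uniq_ancestors_first hs.
  by case/andP: hs.
by rewrite (mem_ancestors_first hs).
Qed.

End Traversals.

Lemma forests_avoiding_top f : f \in forests_avoiding n [:: pat213; rcons rho r'] ->
  is_forest f /\ traversal_inv f sigma r predT id.
Proof.
rewrite inE => /and3P[hf f213]; rewrite andbT => ftau; split=> //.
by apply/traversal_inv_predT => //; apply/andP.
Qed.

Lemma forests_avoiding_bottom f :
  f \in forests_avoiding n [:: pat213; rcons (rcons sigma r') r] ->
  is_forest f /\ traversal_inv f sigma r pred0 id.
Proof.
rewrite inE => /and3P[hf f213]; rewrite andbT => ftau; split=> //.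
by apply/traversal_inv_pred0 => //; apply/andP.
Qed.

Lemma named_by_top f l : is_forest f -> traversal_inv f sigma r predT l ->
  named_by f l \in forests_avoiding n [:: pat213; rcons rho r'].
Proof.
move=> hf invl; have [linj _ _ _] := invl.
rewrite inE named_by_forest //= !avoids_named_by // andbT.
exact/traversal_inv_predT.
Qed.

Lemma named_by_bottom f l : is_forest f -> traversal_inv f sigma r pred0 l ->
  named_by f l \in forests_avoiding n [:: pat213; rcons (rcons sigma r') r].
Proof.
move=> hf invl; have [linj _ _ _] := invl.
rewrite inE named_by_forest //= !avoids_named_by // andbT.
exact/traversal_inv_pred0.
Qed.

Variables ord_a ord_b : parents n -> seq 'I_n.
Hypotheses (hord_a : forall f, is_forest f -> ancestors_first f (ord_a f))
  (hord_b : forall f, is_forest f -> ancestors_first f (ord_b f)).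

Lemma alpha_beta_inverse :
  let Ftilde := forests_avoiding n [:: pat213; rcons (rcons sigma r') r] in
  let Ftau := forests_avoiding n [:: pat213; rcons rho r'] in
  [/\ {in Ftilde, forall f, alpha rho ord_a f \in Ftau},
      {in Ftau, forall f, beta rho ord_b f \in Ftilde},
      {in Ftilde, cancel (alpha rho ord_a) (beta rho ord_b)} &
      {in Ftau, cancel (beta rho ord_b) (alpha rho ord_a)}].
Proof.
split=> f.
- case/forests_avoiding_bottom => hf invf.
  have [invl _] := shuffle_orders hf (hord_a hf) (hord_a hf) invf.
  exact: named_by_top.
- case/forests_avoiding_top => hf invf.
  have [invl _] := antishuffle_orders hf (hord_b hf) (hord_b hf) invf.
  exact: named_by_bottom.
- case/forests_avoiding_bottom => hf invf; rewrite /alpha.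
  set l := foldl _ _ _.
  have linj : injective l.
    by have [[]] := shuffle_orders hf (hord_a hf) (hord_a hf) invf.
  set s := ord_b (named_by f l).
  (* The order chosen for the image forest is pulled back to [f], so that both traversals run over
     the same vertices. *)
  have hs : ancestors_first f (map (finv l) s).
    by apply: named_by_ancestors_first => //; apply/hord_b/named_by_forest.
  have [_ e] := shuffle_orders hf (hord_a hf) hs invf.
  rewrite /beta -/s; apply: named_byK => //.
  rewrite -[in X in foldl _ _ X](mapK (f_finv linj) s).
  rewrite (foldl_named_by _ _ (named_by_antishuffle_step f linj rho)).
  exact: e.
case/forests_avoiding_top => hf invf; rewrite /beta.
set l := foldl _ _ _.
have linj : injective l.
  by have [[]] := antishuffle_orders hf (hord_b hf) (hord_b hf) invf.
set s := ord_a (named_by f l).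
have hs : ancestors_first f (map (finv l) s).
  by apply: named_by_ancestors_first => //; apply/hord_a/named_by_forest.
have [_ e] := antishuffle_orders hf (hord_b hf) hs invf.
rewrite /alpha -/s; apply: named_byK => //.
rewrite -[in X in foldl _ _ X](mapK (f_finv linj) s) -map_rev.
rewrite (foldl_named_by _ _ (named_by_shuffle_step f linj rho)).
exact: e.
Qed.

End Bijection.

(** The general result is applied with the first [k - 2] entries of [tau] as [sigma], followed by
    [k - 1] and [k]; [3 <= k] makes [sigma] nonempty. *)
Theorem theorem4p8 (n k : nat) (hk : 3 <= k) (tau : seq nat)
    (htau : tau \in permutations (iota 1 k))
    (htau1 : nth 0 tau (k - 2) = k - 1)
    (htau2 : nth 0 tau (k - 1) = k)
    (ord_a ord_b : parents n -> seq 'I_n)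
    (hord_a : forall f, is_forest f -> ancestors_first f (ord_a f))
    (hord_b : forall f, is_forest f -> ancestors_first f (ord_b f)) :
  let Ftilde := forests_avoiding n [:: pat213; tilde k tau] in
  let Ftau := forests_avoiding n [:: pat213; tau] in
  let alpha_map := alpha (bar k tau) ord_a in
  let beta_map := beta (bar k tau) ord_b in
  [/\ {in Ftilde, forall f, alpha_map f \in Ftau},
      {in Ftau, forall f, beta_map f \in Ftilde},
      {in Ftilde, cancel alpha_map beta_map} &
      {in Ftau, cancel beta_map alpha_map}].
Proof.
have ptau : perm_eq tau (iota 1 k) by rewrite mem_permutations in htau.
have sz : size tau = k by rewrite (perm_size ptau) size_iota.
have tauE : tau = rcons (rcons (take (k - 2) tau) (k - 1)) k.
  have k2 : k - 2 < size tau by lia.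
  have k1 : k - 1 < size tau by lia.
  have := take_nth 0 k2; rewrite htau1 => <-.
  have -> : (k - 2).+1 = k - 1 by lia.
  have := take_nth 0 k1; rewrite htau2 => <-.
  by rewrite take_oversize //; lia.
have tau_lt : all (ltn^~ (k - 1)) (take (k - 2) tau).
  apply/allP => x xt; have : x \in iota 1 k.
    by rewrite -(perm_mem ptau); apply: mem_take xt.
  (* The entries of [tau] are distinct, so an entry of the prefix is neither [k - 1] nor [k]. *)
  have := iota_uniq 1 k; rewrite -(perm_uniq ptau) tauE !rcons_uniq.
  rewrite mem_rcons inE negb_or => /and3P[/andP[_ kt] k1t _].
  have xk : x != k by apply: contraNneq kt => e; rewrite -{1}e.
  have xk1 : x != k - 1 by apply: contraNneq k1t => e; rewrite -{1}e.
  by rewrite mem_iota /=; lia.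
have tau_neq0 : take (k - 2) tau != [::] by rewrite -size_eq0 size_take sz; case: ifP; lia.
have tildeE : tilde k tau = rcons (rcons (take (k - 2) tau) k) (k - 1).
  by rewrite /tilde -!cats1 -catA.
have k1k : k - 1 < k by lia.
have := alpha_beta_inverse tau_lt k1k tau_neq0 hord_a hord_b.
by rewrite -tauE -tildeE.
Qed.
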